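(* Let $m\ge1$ and $n\ge 2$ be integers, let $A_n^2,\dots,A_n^n$ be scalar functions of $x$ such that the scalar equation $w^{(n)}+A_n^2 w^{(n-2)}+\dots+A_n^n w=0$ is iterative, generated by an operator with source parameter $r$, and let $u$ and $v$ be two linearly independent solutions of the second-order source equation $$y''+\mathfrak{q}\,y=0,\qquad \mathfrak{q}=\frac{(r')^2-2rr''}{4r^2}.$$ Then the general solution $\mathbf{w}=(w_1,\dots,w_m)$ of the system $$\mathbf{w}^{(n)}+A_n^2\,I_m\,\mathbf{w}^{(n-2)}+\dots+A_n^n\,I_m\,\mathbf{w}=0$$ is given by $$w_i=\sum_{j=1}^n C_{ij}\,u^{n-j}v^{j-1},\qquad i=1,\dots,m,$$ where the $C_{ij}$ are arbitrary scalars.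
   Context: The base field $\mathbb{K}$ is a field of characteristic zero; functions are smooth functions of the independent variable $x$; $I_m$ is the identity matrix of order $m$. Iterative scalar equations: for scalar functions $r$ (invertible, i.e. nonvanishing) and $s$, let $\Psi=r\frac{d}{dx}+s$, $\Psi[w]=rw'+sw$, $\Psi^0=\mathrm{Id}$, and $\Psi^n[w]=\Psi^{n-1}[\Psi[w]]$ for $n\ge 1$. Write $\Psi^n[w]=K_n^0w^{(n)}+K_n^1w^{(n-1)}+\dots+K_n^nw$, where $K_n^0=r^n$. A scalar equation in normal form $w^{(n)}+A_n^2w^{(n-2)}+\dots+A_n^nw=0$ is iterative with source parameter $r$ if, taking $s=-\tfrac12(n-1)r'$ (which is equivalent to $K_n^1=0$), one has $A_n^j=K_n^j/r^n$ for $2\le j\le n$, i.e. if it is $r^{-n}\Psi^n[w]=0$. *)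

(* Defs.v *)
From HB Require Import structures.
From mathcomp Require Import all_boot all_order all_algebra.
From mathcomp Require Import boolp classical_sets functions reals.
From mathcomp Require Import topology normedtype derive realfun.
From mathcomp Require Import complex.
From mathcomp Require Import ring.

Set Implicit Arguments.
Unset Strict Implicit.
Unset Printing Implicit Defensive.

Import Order.TTheory GRing.Theory Num.Theory numFieldNormedType.Exports.

Local Open Scope classical_set_scope.
Local Open Scope ring_scope.

(* "Smooth K-valued functions of the independent variable x" has no intrinsic
   meaning over an arbitrary field K, so the notion is a parameter: functions
   on a domain, closed under the usual operations, with a derivation whose
   constants are the constant functions.  The functions are total and only
   their values on the domain matter.  [real_smooth] and [complex_smooth]
   below are the instances of C^oo real- and complex-valued functions on an
   open interval of the real line. *)
Record smoothFunctions (K : fieldType) := SmoothFunctions {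
  fpoint : Type;
  fdom : set fpoint;
  fvar : fpoint -> K;
  smooth : (fpoint -> K) -> Prop;
  fderiv : (fpoint -> K) -> fpoint -> K;
  smooth_ext : forall f g,
    (forall x, fdom x -> f x = g x) -> smooth f -> smooth g;
  fderiv_ext : forall f g, smooth f ->
    (forall x, fdom x -> f x = g x) ->
    forall x, fdom x -> fderiv f x = fderiv g x;
  smooth_fderiv : forall f, smooth f -> smooth (fderiv f);
  smooth_fvar : smooth fvar;
  fderiv_fvar : forall x, fdom x -> fderiv fvar x = 1;
  smooth_cst : forall c : K, smooth (fun=> c);
  fderiv_eq0 : forall f, smooth f ->
    (forall x, fdom x -> fderiv f x = 0) <->
    (exists c : K, forall x, fdom x -> f x = c);
  smoothD : forall f g, smooth f -> smooth g -> smooth (fun x => f x + g x);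
  fderivD : forall f g, smooth f -> smooth g ->
    forall x, fdom x -> fderiv (fun y => f y + g y) x = fderiv f x + fderiv g x;
  smoothM : forall f g, smooth f -> smooth g -> smooth (fun x => f x * g x);
  fderivM : forall f g, smooth f -> smooth g ->
    forall x, fdom x ->
      fderiv (fun y => f y * g y) x = fderiv f x * g x + f x * fderiv g x;
  smoothV : forall f, smooth f -> (forall x, fdom x -> f x != 0) ->
    smooth (fun x => (f x)^-1)
}.

Section Equations.
Variables (K : fieldType) (S : smoothFunctions K).
Local Notation fct := (fpoint S -> K).

Definition nderiv (n : nat) (f : fct) : fct := iter n (@fderiv K S) f.

Definition lin_indep2 (u v : fct) : Prop :=
  forall a b : K, (forall x, fdom x -> a * u x + b * v x = 0) ->
    a = 0 /\ b = 0.

Definition Psi (r s : fct) (w : fct) : fct :=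
  fun x => r x * fderiv w x + s x * w x.

(* Psi^n [w] = k 0 * w^(n) + k 1 * w^(n-1) + ... + k n * w; these coefficients
   are unique on the domain, as seen by taking for w the powers of the
   independent variable (in characteristic 0). *)
Definition Psi_coefs (r s : fct) (n : nat) (k : nat -> fct) : Prop :=
  (forall j, (j <= n)%N -> smooth (k j)) /\
  (forall w, smooth w -> forall x, fdom x ->
     iter n (Psi r s) w x = \sum_(0 <= j < n.+1) k j x * nderiv (n - j) w x).

(* A j is used for 2 <= j <= n only. *)
Definition iterative (n : nat) (A : nat -> fct) (r : fct) : Prop :=
  [/\ smooth r, (forall x, fdom x -> r x != 0) &
    exists2 k : nat -> fct,
      Psi_coefs r (fun x => - (2^-1 * (n.-1)%:R * fderiv r x)) n k &
      forall j, (2 <= j <= n)%N ->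
        forall x, fdom x -> A j x = k j x / r x ^+ n].

Definition source_coef (r : fct) : fct :=
  fun x => (fderiv r x ^+ 2 - 2 * r x * nderiv 2 r x) / (4 * r x ^+ 2).

Definition source_solution (r y : fct) : Prop :=
  smooth y /\
  forall x, fdom x -> nderiv 2 y x + source_coef r x * y x = 0.

Definition vnderiv (m n : nat) (w : fpoint S -> 'cV[K]_m) : fpoint S -> 'cV[K]_m :=
  fun x => \col_i nderiv n (fun y => w y i 0) x.

Definition system_solution (m n : nat) (A : nat -> fct)
    (w : fpoint S -> 'cV[K]_m) : Prop :=
  (forall i, smooth (fun x => w x i 0)) /\
  forall x, fdom x ->
    vnderiv n w x +
    \sum_(2 <= j < n.+1) (A j x *: 1%:M) *m vnderiv (n - j) w x = 0.

End Equations.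

Section RealSmooth.
Variable R : realType.
Implicit Types (I : set R) (f g : R -> R).

Definition real_smooth_on I f : Prop :=
  forall (n : nat) x, I x -> derivable (derive1n n f) x 1.

(* Smoothness up to order n, for inductions. *)
Let upto I n f := forall k, (k < n)%N -> forall x, I x -> derivable (derive1n k f) x 1.

Let uptoS I n f :
  upto I n.+1 f <-> (forall x, I x -> derivable f x 1) /\ upto I n (derive1 f).
Proof.
split=> [H|[H0 H] [|k] kn x Ix]; last 2 first.
- exact: H0.
- by rewrite /derive1n iterSr; apply: H.
split=> [x Ix|k kn x Ix]; first exact: (H 0%N).
by have := H k.+1 kn x Ix; rewrite /derive1n iterSr.
Qed.

Let uptoW I n f : upto I n.+1 f -> upto I n f.
Proof. by move=> H k kn; apply: H; apply: ltnW. Qed.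

Let uptoP I f : real_smooth_on I f <-> forall n, upto I n f.
Proof. by split=> [H n k _|H n]; [exact: H | exact: (H n.+1 n)]. Qed.

Let near_on I f g : open I -> (forall x, I x -> f x = g x) ->
  forall x, I x -> \forall y \near x, f y = g y.
Proof.
move=> oI fg x Ix; have : nbhs x I by exact: open_nbhs_nbhs.
by apply: filterS => y; apply: fg.
Qed.

Let derive1_ext I f g : open I -> (forall x, I x -> f x = g x) ->
  forall x, I x -> (derive1 f) x = (derive1 g) x.
Proof.
move=> oI fg x Ix; rewrite !derive1E.
exact: near_eq_derive (near_on oI fg Ix).
Qed.

Let upto_ext I n f g : open I -> (forall x, I x -> f x = g x) ->
  upto I n f -> upto I n g.
Proof.
move=> oI; elim: n f g => [//|n IH] f g fg /uptoS[df Hf].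
apply/uptoS; split; last exact: IH (derive1_ext oI fg) Hf.
move=> x Ix.
exact: near_eq_derivable (near_on oI fg Ix) (df x Ix).
Qed.

Let upto_cst I n (c : R) : upto I n (fun=> c).
Proof.
elim: n c => [//|n IH] c; apply/uptoS; split=> [x _|]; first exact: derivable_cst.
have -> : (derive1 (fun=> c : R)) = (fun=> 0 : R) :> (R -> R).
  by apply/funext => x; rewrite derive1_cst.
exact: IH.
Qed.

Let derive1_add f g x : derivable f x 1 -> derivable g x 1 ->
  derive1 (fun y => f y + g y) x = (derive1 f) x + (derive1 g) x.
Proof. by move=> df dg; rewrite !derive1E deriveD. Qed.

Let derive1_mul f g x : derivable f x 1 -> derivable g x 1 ->
  derive1 (fun y => f y * g y) x = (derive1 f) x * g x + f x * (derive1 g) x.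
Proof.
move=> df dg; rewrite !derive1E deriveM// addrC; congr (_ + _).
by rewrite [_ *: _]mulrC.
Qed.

Let upto_add I n f g : open I -> upto I n f -> upto I n g ->
  upto I n (fun x => f x + g x).
Proof.
move=> oI; elim: n f g => [//|n IH] f g /uptoS[df Hf] /uptoS[dg Hg].
apply/uptoS; split=> [x Ix|]; first by apply: derivableD; [exact: df|exact: dg].
apply: (upto_ext oI _ (IH _ _ Hf Hg)) => x Ix.
by rewrite derive1_add//; [exact: df|exact: dg].
Qed.

Let upto_mul I n f g : open I -> upto I n f -> upto I n g ->
  upto I n (fun x => f x * g x).
Proof.
move=> oI; elim: n f g => [//|n IH] f g Hf0 Hg0.
have [df Hf] := (uptoS I n f).1 Hf0; have [dg Hg] := (uptoS I n g).1 Hg0.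
apply/uptoS; split=> [x Ix|]; first by apply: derivableM; [exact: df|exact: dg].
have H := upto_add oI (IH _ _ Hf (uptoW Hg0)) (IH _ _ (uptoW Hf0) Hg).
apply: (upto_ext oI _ H) => x Ix.
by rewrite derive1_mul//; [exact: df|exact: dg].
Qed.

Let upto_inv I n f : open I -> (forall x, I x -> f x != 0) ->
  upto I n f -> upto I n (fun x => (f x)^-1).
Proof.
move=> oI f0; elim: n => [//|n IH] Hf0.
have [df Hf] := (uptoS I n f).1 Hf0.
apply/uptoS; split=> [x Ix|]; first by apply: derivableV; [exact: f0|exact: df].
have Hv := IH (uptoW Hf0).
have H := upto_mul oI (@upto_cst I n (-1))
            (upto_mul oI Hf (upto_mul oI Hv Hv)).
apply: (upto_ext oI _ H) => x Ix.
rewrite !derive1E deriveV; [|exact: f0|exact: df].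
rewrite /GRing.scale /= -exprVn expr2; ring.
Qed.

Let derive1_eq0_cst I f : open I -> is_interval I -> real_smooth_on I f ->
  (forall x, I x -> (derive1 f) x = 0) <-> (exists c : R, forall x, I x -> f x = c).
Proof.
move=> oI iI sf; split=> [f0|[c fc] x Ix]; last first.
  by rewrite (derive1_ext oI fc Ix) derive1_cst.
have [->|/set0P[a Ia]] := eqVneq I set0; first by exists 0.
have key x y : I x -> I y -> x < y -> f x = f y.
  move=> Ix Iy xy.
  have sub z : x <= z <= y -> I z by exact: iI.
  have der z : z \in `]x, y[ -> is_derive z 1 f 0.
    rewrite in_itv/= => /andP[xz zy].
    have Iz : I z by apply: sub; rewrite !ltW.
    by have := derivableP (sf 0%N z Iz); rewrite /= -derive1E f0.
  have cont : {within `[x, y], continuous f}.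
    apply: derivable_within_continuous => z; rewrite in_itv/= => /sub Iz.
    exact: (sf 0%N z Iz).
  have [c _] := MVT xy der cont.
  by rewrite mul0r => /eqP; rewrite subr_eq0 => /eqP.
exists (f a) => x Ix; case: (ltgtP x a) => [xa|ax|-> //].
  exact: key.
by rewrite (key a x).
Qed.

Lemma real_smooth_fderiv I f : real_smooth_on I f -> real_smooth_on I (derive1 f).
Proof. by move=> sf n x Ix; have := sf n.+1 x Ix; rewrite /derive1n iterSr. Qed.

Definition real_smooth (I : set R) (oI : open I) (iI : is_interval I) :
  smoothFunctions R.
Proof.
refine (@SmoothFunctions R R I id (real_smooth_on I) (@derive1 R R)
  _ _ _ _ _ _ _ _ _ _ _ _).
- by move=> f g fg /uptoP sf; apply/uptoP => n; apply: upto_ext (sf n).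
- by move=> f g _ fg; apply: derive1_ext.
- exact: real_smooth_fderiv.
- apply/uptoP => -[//|n]; apply/uptoS; split=> [x _|]; first exact: derivable_id.
  have -> : derive1 (@id R) = (fun=> 1) by apply/funext => x; rewrite derive1_id.
  exact: upto_cst.
- by move=> x _; rewrite derive1_id.
- by move=> c; apply/uptoP => n; apply: upto_cst.
- by move=> f; apply: derive1_eq0_cst.
- move=> f g /uptoP sf /uptoP sg; apply/uptoP => n; exact: upto_add.
- by move=> f g sf sg x Ix; apply: derive1_add; [exact: (sf 0%N)|exact: (sg 0%N)].
- move=> f g /uptoP sf /uptoP sg; apply/uptoP => n; exact: upto_mul.
- by move=> f g sf sg x Ix; apply: derive1_mul; [exact: (sf 0%N)|exact: (sg 0%N)].
- move=> f /uptoP sf f0; apply/uptoP => n; exact: upto_inv.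
Defined.

End RealSmooth.

Section FunctionLemmas.
Variables (K : fieldType) (S : smoothFunctions K).
Implicit Types f g : fpoint S -> K.

Lemma fderiv_cst (c : K) (x : fpoint S) : fdom x -> fderiv (fun=> c) x = 0.
Proof. by move=> Ix; apply: (fderiv_eq0 (smooth_cst S c)).2 Ix; exists c. Qed.

Lemma smoothN f : smooth f -> smooth (fun x => - f x).
Proof.
move=> sf; apply: smooth_ext (smoothM (smooth_cst S (-1)) sf) => x _.
by rewrite mulN1r.
Qed.

Lemma fderivN f : smooth f ->
  forall x, fdom x -> fderiv (fun y => - f y) x = - fderiv f x.
Proof.
move=> sf x Ix; have s1 := smooth_cst S (-1).
have E y : fdom y -> - f y = -1 * f y by rewrite mulN1r.
rewrite (fderiv_ext (smoothN sf) E Ix) (fderivM s1 sf Ix) fderiv_cst//.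
by rewrite mul0r add0r mulN1r.
Qed.

Lemma smoothB f g : smooth f -> smooth g -> smooth (fun x => f x - g x).
Proof. by move=> sf /smoothN; apply: smoothD. Qed.

Lemma fderivB f g : smooth f -> smooth g ->
  forall x, fdom x -> fderiv (fun y => f y - g y) x = fderiv f x - fderiv g x.
Proof.
move=> sf sg x Ix; have sNg := smoothN sg.
by rewrite (fderivD sf sNg Ix) fderivN.
Qed.

End FunctionLemmas.

Section ComplexSmooth.
Variables (R : realType) (S : smoothFunctions R).
Local Notation C := (R[i]).
Local Notation re := (@complex.Re R).
Local Notation im := (@complex.Im R).
Implicit Types f g : fpoint S -> C.

(* Complex-valued functions of the same (real) variable, handled through their
   real and imaginary parts. *)
Definition csmooth f : Prop :=
  smooth (fun x => re (f x)) /\ smooth (fun x => im (f x)).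

Definition cderiv f : fpoint S -> C :=
  fun x => (fderiv (fun y => re (f y)) x +i* fderiv (fun y => im (f y)) x)%C.

Let reD (a b : C) : re (a + b) = re a + re b. Proof. by case: a b => ? ? []. Qed.
Let imD (a b : C) : im (a + b) = im a + im b. Proof. by case: a b => ? ? []. Qed.
Let reM (a b : C) : re (a * b) = re a * re b - im a * im b.
Proof. by case: a b => ? ? []. Qed.
Let imM (a b : C) : im (a * b) = re a * im b + im a * re b.
Proof. by case: a b => ? ? []. Qed.
Let eqC (a b : C) : re a = re b -> im a = im b -> a = b.
Proof. by case: a b => ? ? [? ?] /= -> ->. Qed.

Let csmoothD f g : csmooth f -> csmooth g -> csmooth (fun x => f x + g x).
Proof.
move=> [fr fi] [gr gi]; split.
  by apply: smooth_ext (smoothD fr gr) => x _; rewrite reD.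
by apply: smooth_ext (smoothD fi gi) => x _; rewrite imD.
Qed.

Let cderivD f g : csmooth f -> csmooth g -> forall x, fdom x ->
  cderiv (fun y => f y + g y) x = cderiv f x + cderiv g x.
Proof.
move=> sf sg x Ix; have [sr si] := csmoothD sf sg.
have [fr fi] := sf; have [gr gi] := sg.
apply: eqC; rewrite ?(reD, imD) /=.
  by rewrite (fderiv_ext sr (fun y _ => reD (f y) (g y)) Ix) (fderivD fr gr Ix).
by rewrite (fderiv_ext si (fun y _ => imD (f y) (g y)) Ix) (fderivD fi gi Ix).
Qed.

Let csmoothM f g : csmooth f -> csmooth g -> csmooth (fun x => f x * g x).
Proof.
move=> [fr fi] [gr gi]; split.
  apply: smooth_ext (smoothB (smoothM fr gr) (smoothM fi gi)) => x _.
  by rewrite reM.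
apply: smooth_ext (smoothD (smoothM fr gi) (smoothM fi gr)) => x _.
by rewrite imM.
Qed.

Let cderivM f g : csmooth f -> csmooth g -> forall x, fdom x ->
  cderiv (fun y => f y * g y) x = cderiv f x * g x + f x * cderiv g x.
Proof.
move=> sf sg x Ix; have [sr si] := csmoothM sf sg.
have [fr fi] := sf; have [gr gi] := sg.
apply: eqC; rewrite ?(reD, imD, reM, imM) /=.
  rewrite (fderiv_ext sr (fun y _ => reM (f y) (g y)) Ix).
  rewrite (fderivB (smoothM fr gr) (smoothM fi gi) Ix).
  rewrite (fderivM fr gr Ix) (fderivM fi gi Ix); ring.
rewrite (fderiv_ext si (fun y _ => imM (f y) (g y)) Ix).
rewrite (fderivD (smoothM fr gi) (smoothM fi gr) Ix).
rewrite (fderivM fr gi Ix) (fderivM fi gr Ix); ring.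
Qed.

Let cderiv_eq0 f : csmooth f ->
  (forall x, fdom x -> cderiv f x = 0) <->
  (exists c : C, forall x, fdom x -> f x = c).
Proof.
move=> [sr si]; split=> [H|[c H] x Ix].
  have [|a Ha] := (fderiv_eq0 sr).1 _; first by move=> x /H[].
  have [|b Hb] := (fderiv_eq0 si).1 _; first by move=> x /H[].
  by exists (a +i* b)%C => x Ix; apply: eqC; rewrite ?Ha ?Hb.
apply: eqC => /=.
  by apply: (fderiv_eq0 sr).2 Ix; exists (re c) => y Iy; rewrite H.
by apply: (fderiv_eq0 si).2 Ix; exists (im c) => y Iy; rewrite H.
Qed.

Let csmoothV f : csmooth f -> (forall x, fdom x -> f x != 0) ->
  csmooth (fun x => (f x)^-1).
Proof.
move=> [fr fi] f0.
have sN := smoothD (smoothM fr fr) (smoothM fi fi).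
have sV := smoothV sN.
have /sV{}sV : forall x, fdom x ->
    re (f x) * re (f x) + im (f x) * im (f x) != 0.
  move=> x Ix; have := f0 x Ix; apply: contra_neq => /eqP.
  rewrite -!expr2 paddr_eq0 ?sqr_ge0// !expf_eq0/= => /andP[/eqP? /eqP?].
  exact: eqC.
split.
  apply: smooth_ext (smoothM fr sV) => x _.
  by case: (f x) => a b /=; rewrite !expr2.
apply: smooth_ext (smoothN (smoothM fi sV)) => x _.
by case: (f x) => a b /=; rewrite !expr2.
Qed.

Definition complexify : smoothFunctions C.
Proof.
refine (@SmoothFunctions C (fpoint S) (@fdom _ S)
  (fun x => (fvar x)%:C%C) csmooth cderiv
  _ _ _ _ _ _ cderiv_eq0 csmoothD cderivD csmoothM cderivM csmoothV).
- move=> f g fg [sr si].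
  by split; [apply: smooth_ext sr | apply: smooth_ext si] => x Ix; rewrite fg.
- move=> f g [sr si] fg x Ix.
  by apply: eqC; apply: fderiv_ext => // y Iy; rewrite fg.
- by move=> f [sr si]; split; apply: smooth_fderiv.
- by split; [exact: smooth_fvar | exact: smooth_cst].
- move=> x Ix; apply: eqC; first exact: fderiv_fvar.
  exact: fderiv_cst.
- by move=> c; split; apply: smooth_cst.
Defined.

End ComplexSmooth.

Definition complex_smooth (R : realType) (I : set R) (oI : open I)
    (iI : is_interval I) : smoothFunctions R[i] :=
  complexify (real_smooth oI iI).

(* Main.v *)
Require Import Defs.
From mathcomp Require Import all_boot all_order all_algebra.
From mathcomp Require Import ring.

Set Implicit Arguments.
Unset Strict Implicit.
Unset Printing Implicit Defensive.

Import GRing.Theory.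
Local Open Scope ring_scope.

(** Write Psi2 for the operator Psi with parameters r and - r' / 2.  Then
Psi2 (Psi2 y) = r^2 (y'' + q y), so the source equation is Psi2^2 [y] = 0, and
the operator that generates the equation of order n has the parameters r and
- (n - 1) r' / 2.

The only analytic fact about the functions is that those with zero derivative
are the constants; it replaces existence and uniqueness theorems for linear
differential equations because everything can be integrated explicitly.  If
Psi2 f = Psi2 g = 0 then f g / r is constant, so the kernel of Psi2 is at most
a line, spanned by a nonvanishing function ([Psi2_ker_line]).  Therefore the
span of u and v has a basis p, y with Psi2 p = 0, Psi2 y = p and p nonvanishing
([adapted_basis]).  The ratio t = y / p satisfies r t' = 1.

The power p^(n-1) is killed by the operator of order n, whence
Psi^n [p^(n-1) g] = p^(n-1) (r d/dx)^n g ([iter_Psi_mul]).  Since r d/dx is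
d/dt, its n-th iterate kills exactly the polynomials in t of degree less than n
([iter_rD_ker]).  The solutions of Psi^n [w] = 0 are thus the functions
p^(n-1) P(y / p), that is, the binary forms of degree n - 1 in p and y, or
equivalently in u and v ([iter_Psi_ker]).

To know that the given equation is r^(-n) Psi^n [w] = 0, the first two
coefficients of Psi^n must be r^n and 0, whichever coefficients witness
iterativity; they are computed in [Psi_coef0] and [Psi_coef1] and carried over
by [Psi_coefs_uniq].  The system is diagonal, so the scalar result applies to
each component. *)

(** * Calculus of derivatives on the domain *)

Section HasDeriv.
Variables (K : fieldType) (S : smoothFunctions K).
Local Notation fct := (fpoint S -> K).
Implicit Types f g : fct.

(** Pairing smoothness with the value of the derivative lets derivatives of
compound expressions be built by applying the rules below to one another. *)
Definition has_deriv (f f' : fct) : Prop :=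
  smooth f /\ forall x, fdom x -> fderiv f x = f' x.

Lemma has_deriv_fderiv f : smooth f -> has_deriv f (fderiv f).
Proof. by []. Qed.

Lemma has_deriv_eq f f' g' : (forall x, fdom x -> f' x = g' x) ->
  has_deriv f f' -> has_deriv f g'.
Proof. by move=> E [sf df]; split=> // x Ix; rewrite df// E. Qed.

Lemma has_deriv_ext f g f' : (forall x, fdom x -> f x = g x) ->
  has_deriv f f' -> has_deriv g f'.
Proof.
move=> E [sf df]; split=> [|x Ix]; first exact: smooth_ext sf.
by rewrite -df//; apply/esym; apply: fderiv_ext Ix.
Qed.

Lemma has_deriv_cst (c : K) : has_deriv (fun=> c) (fun=> 0).
Proof. by split=> [|x Ix]; [exact: smooth_cst | exact: fderiv_cst]. Qed.

Lemma has_derivD f g f' g' : has_deriv f f' -> has_deriv g g' ->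
  has_deriv (fun x => f x + g x) (fun x => f' x + g' x).
Proof.
move=> [sf df] [sg dg]; split=> [|x Ix]; first exact: smoothD.
by rewrite fderivD// df// dg.
Qed.

Lemma has_derivM f g f' g' : has_deriv f f' -> has_deriv g g' ->
  has_deriv (fun x => f x * g x) (fun x => f' x * g x + f x * g' x).
Proof.
move=> [sf df] [sg dg]; split=> [|x Ix]; first exact: smoothM.
by rewrite fderivM// df// dg.
Qed.

Lemma has_derivZ c f f' : has_deriv f f' ->
  has_deriv (fun x => c * f x) (fun x => c * f' x).
Proof.
move=> df; apply: has_deriv_eq (has_derivM (has_deriv_cst c) df) => x _.
by rewrite mul0r add0r.
Qed.

Lemma has_derivN f f' : has_deriv f f' ->
  has_deriv (fun x => - f x) (fun x => - f' x).
Proof.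
move=> [sf df]; split=> [|x Ix]; first exact: smoothN.
by rewrite fderivN// df.
Qed.

Lemma has_derivB f g f' g' : has_deriv f f' -> has_deriv g g' ->
  has_deriv (fun x => f x - g x) (fun x => f' x - g' x).
Proof. by move=> df /has_derivN; apply: has_derivD. Qed.

Lemma has_derivX n f f' : has_deriv f f' ->
  has_deriv (fun x => f x ^+ n) (fun x => n%:R * f x ^+ n.-1 * f' x).
Proof.
move=> df; elim: n => [|n IH].
  by apply: has_deriv_eq (has_deriv_cst 1) => x _; rewrite !mul0r.
have E x : f x * f x ^+ n = f x ^+ n.+1 by rewrite exprS.
apply: has_deriv_ext (fun x _ => E x) _.
apply: has_deriv_eq (has_derivM df IH) => x _ /=.
by case: n {IH E} => [|n] /=; rewrite ?expr0 ?exprS; ring.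
Qed.

Lemma has_derivV f f' : (forall x, fdom x -> f x != 0) -> has_deriv f f' ->
  has_deriv (fun x => (f x)^-1) (fun x => - f' x / f x ^+ 2).
Proof.
move=> f0 df; have dV := has_deriv_fderiv (smoothV df.1 f0).
apply: has_deriv_eq (dV) => x Ix.
(* Differentiate f * f^-1 = 1. *)
have /has_deriv_ext : forall x, fdom x -> f x * (f x)^-1 = 1.
  by move=> y Iy; rewrite mulfV ?f0.
move=> /(_ _ (has_derivM df dV))[_ /(_ x Ix)].
rewrite (has_deriv_cst 1).2// => E.
have fx0 := f0 x Ix.
have -> : fderiv (fun x => (f x)^-1) x
  = (0 - f' x / f x) / f x by rewrite E; field.
by field.
Qed.

Lemma has_deriv_sum n (F F' : nat -> fct) :
  (forall j, (j < n)%N -> has_deriv (F j) (F' j)) ->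
  has_deriv (fun x => \sum_(0 <= j < n) F j x) (fun x => \sum_(0 <= j < n) F' j x).
Proof.
elim: n => [|n IH] H.
  apply: has_deriv_ext (has_deriv_eq _ (has_deriv_cst 0)) => x _;
  by rewrite big_geq.
apply: has_deriv_ext (has_deriv_eq _
  (has_derivD (IH (fun j jn => H j (ltnW jn))) (H n (ltnSn n)))) => x _;
by rewrite big_nat_recr.
Qed.

Lemma has_deriv_horner (P : {poly K}) f f' : has_deriv f f' ->
  has_deriv (fun x => P.[f x]) (fun x => P^`().[f x] * f' x).
Proof.
move=> df; elim/poly_ind: P => [|P c IH].
  apply: has_deriv_ext (has_deriv_eq _ (has_deriv_cst 0)) => x _;
  by rewrite ?deriv0 horner0 ?mul0r.
apply: has_deriv_ext (has_deriv_eq _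
  (has_derivD (has_derivM IH df) (has_deriv_cst c))) => x _.
  by rewrite hornerMXaddC.
by rewrite derivMXaddC hornerD hornerMX; ring.
Qed.

Lemma has_deriv0_cst f : has_deriv f (fun=> 0) ->
  exists c, forall x, fdom x -> f x = c.
Proof. by move=> [sf df]; apply/(fderiv_eq0 sf). Qed.

Lemma smooth_nderiv n f : smooth f -> smooth (nderiv n f).
Proof. by move=> sf; elim: n => //= n; apply: smooth_fderiv. Qed.

End HasDeriv.

(** * Coefficients of the iterates of Psi *)

Section PsiTheory.
Variables (K : fieldType) (S : smoothFunctions K).
Local Notation fct := (fpoint S -> K).
Implicit Types f g w : fct.
Variables (r s : fct) (sr : smooth r) (ss : smooth s).

Lemma smooth_Psi f : smooth f -> smooth (Psi r s f).
Proof.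
by move=> sf; apply: smoothD; apply: smoothM => //; apply: smooth_fderiv.
Qed.

Lemma smooth_iter_Psi n f : smooth f -> smooth (iter n (Psi r s) f).
Proof. by move=> sf; elim: n => //= n; apply: smooth_Psi. Qed.

Lemma Psi_deriv f f' x : has_deriv f f' -> fdom x ->
  Psi r s f x = r x * f' x + s x * f x.
Proof. by move=> [_ df] Ix; rewrite /Psi df. Qed.

Lemma Psi_ext f g : smooth f -> (forall x, fdom x -> f x = g x) ->
  forall x, fdom x -> Psi r s f x = Psi r s g x.
Proof. by move=> sf E x Ix; rewrite /Psi (fderiv_ext sf E Ix) E. Qed.

Lemma iter_Psi_ext n f g : smooth f -> (forall x, fdom x -> f x = g x) ->
  forall x, fdom x -> iter n (Psi r s) f x = iter n (Psi r s) g x.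
Proof.
move=> sf E; elim: n => [//|n IH] x Ix /=.
by apply: Psi_ext Ix => //; apply: smooth_iter_Psi.
Qed.

(** The coefficients K_k^j, for all j: applying Psi to K_k^j w^(k-j) contributes
r K_k^j to the coefficient of w^(k+1-j) and Psi[K_k^j] to that of w^(k-j). *)
Fixpoint Psi_coef (k j : nat) : fct :=
  match k, j with
  | 0, 0 => fun=> 1
  | 0, _.+1 => fun=> 0
  | k.+1, 0 => fun x => r x * Psi_coef k 0 x
  | k.+1, j.+1 => fun x => r x * Psi_coef k j.+1 x + Psi r s (Psi_coef k j) x
  end.

Lemma smooth_Psi_coef k j : smooth (Psi_coef k j).
Proof.
elim: k j => [|k IH] [|j] /=; try exact: smooth_cst.
  exact: smoothM.
by apply: smoothD; [exact: smoothM | exact: smooth_Psi].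
Qed.

Lemma Psi_coef_gt k j : (k < j)%N -> forall x, fdom x -> Psi_coef k j x = 0.
Proof.
elim: k j => [|k IH] [|j] //= kj x Ix.
rewrite IH ?(ltnW kj)// mulr0 add0r.
have := Psi_ext (smooth_Psi_coef k j) (IH j kj) Ix => ->.
by rewrite /Psi fderiv_cst// !mulr0 addr0.
Qed.

Lemma Psi_coefsP n : Psi_coefs r s n (Psi_coef n).
Proof.
split=> [j _|w sw]; first exact: smooth_Psi_coef.
elim: n => [|n IH] x Ix; first by rewrite big_nat1 /= mul1r.
have dsum := has_deriv_sum (fun j (_ : (j < n.+1)%N) =>
  has_derivM (has_deriv_fderiv (smooth_Psi_coef n j))
             (has_deriv_fderiv (smooth_nderiv (n - j) sw))).
rewrite iterS (Psi_ext (smooth_iter_Psi n sw) IH Ix) (Psi_deriv dsum Ix).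
rewrite !mulr_sumr -big_split/= [RHS]big_nat_recl//=.
under [in RHS]eq_bigr => j _ do rewrite subSS mulrDl.
rewrite [in RHS]big_split/= addrA.
have -> : r x * Psi_coef n 0 x * nderiv (n.+1 - 0) w x +
    \sum_(0 <= j < n.+1) r x * Psi_coef n j.+1 x * nderiv (n - j) w x =
    \sum_(0 <= j < n.+1) r x * Psi_coef n j x * nderiv (n.+1 - j) w x.
  rewrite [in LHS]big_nat_recr//= (Psi_coef_gt (ltnSn n) Ix) mulr0 mul0r addr0.
  by rewrite [in RHS]big_nat_recl//=; congr (_ + _).
rewrite -big_split/=; apply: eq_big_nat => j /andP[_ jn].
by rewrite subSn// /Psi [nderiv (n - j).+1 w]/=; ring.
Qed.

Lemma Psi_coef0 k x : Psi_coef k 0 x = r x ^+ k.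
Proof. by elim: k => [|k IH] /=; rewrite ?expr0// IH exprS. Qed.

(** That is, K_k^1 = r^(k-1) (k s + k (k-1) / 2 r'), which vanishes for
s = - (k-1) r' / 2. *)
Lemma Psi_coef1 k x : fdom x ->
  2 * (r x * Psi_coef k 1 x) =
  k%:R * r x ^+ k * (2 * s x + k.-1%:R * fderiv r x).
Proof.
move=> Ix; elim: k => [|k IH] /=; first by rewrite !mulr0 !mul0r.
have E y : fdom y -> Psi_coef k 0 y = r y ^+ k by rewrite Psi_coef0.
rewrite (Psi_ext (smooth_Psi_coef k 0) E Ix).
rewrite (Psi_deriv (has_derivX k (has_deriv_fderiv sr)) Ix).
have -> : 2 * (r x * (r x * Psi_coef k 1 x +
   (r x * (k%:R * r x ^+ k.-1 * fderiv r x) + s x * r x ^+ k))) =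
   r x * (2 * (r x * Psi_coef k 1 x)) +
   2 * (r x * (k%:R * (r x * r x ^+ k.-1) * fderiv r x + s x * r x ^+ k)).
  by ring.
rewrite IH exprS; case: k {IH E} => [|k] /=; first by rewrite expr0; ring.
by rewrite exprS; ring.
Qed.

(** At a point x0, all derivatives of the function (x - x0)^(n-j) vanish except
the one of order n - j, so that Psi^n evaluated on it at x0 is (n-j)! times the
coefficient of index j; characteristic zero makes this factorial invertible. *)
Lemma Psi_coefs_uniq (charK : [pchar K] =i pred0) n (k l : nat -> fct) :
  Psi_coefs r s n k -> Psi_coefs r s n l ->
  forall j, (j <= n)%N -> forall x, fdom x -> k j x = l j x.
Proof.
move=> [_ Hk] [_ Hl] j jn x0 Ix0.
set e : fct := fun x => fvar x - fvar x0.
have de : has_deriv e (fun=> 1).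
  have dx : has_deriv (@fvar K S) (fun=> 1).
    by split; [exact: smooth_fvar | exact: fderiv_fvar].
  have := has_derivB dx (has_deriv_cst S (fvar x0)).
  by apply: has_deriv_eq => x _; rewrite subr0.
pose w : fct := fun x => e x ^+ (n - j).
have dw : has_deriv w _ := has_derivX (n - j) de.
have nw i x : fdom x -> nderiv i w x = ((n - j) ^_ i)%:R * e x ^+ (n - j - i).
  elim: i x => [|i IH] x Ix; first by rewrite ffactn0 mul1r subn0.
  have sw : smooth (nderiv i w) := smooth_nderiv i dw.1.
  rewrite [LHS](fderiv_ext sw IH Ix).
  have [_ ->] := has_derivZ ((n - j) ^_ i)%:R (has_derivX (n - j - i) de) => //.
  by rewrite ffactnSr natrM subnS; ring.
have key k' : (forall w, smooth w -> forall x, fdom x ->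
     iter n (Psi r s) w x = \sum_(0 <= j < n.+1) k' j x * nderiv (n - j) w x) ->
     iter n (Psi r s) w x0 = k' j x0 * ((n - j)`!)%:R.
  move=> /(_ w dw.1 x0 Ix0) ->; rewrite big_mkord.
  rewrite (bigD1 (Ordinal (jn : (j < n.+1)%N)))//= big1 => [|i ij].
    by rewrite addr0 nw// subnn expr0 mulr1 ffactnn.
  rewrite nw// /e subrr.
  have [lt_ij|le_ji] := ltnP i j.
    by rewrite ffact_small ?mul0r ?mulr0// ltn_sub2l// (leq_trans lt_ij).
  have lt_ji : (j < i)%N by rewrite ltn_neqAle le_ji andbT eq_sym.
  have : (0 < n - j - (n - i))%N.
    by rewrite subn_gt0 ltn_sub2l// (leq_trans lt_ji)// -ltnS.
  by case: (n - j - _)%N => // q _; rewrite expr0n /= !mulr0.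
have := key k Hk; rewrite (key l Hl) => /mulIf -> //.
by rewrite ((pcharf0P K).1 charK) -lt0n fact_gt0.
Qed.

End PsiTheory.

(** * Binary forms in two functions *)

Section BinaryForms.
Variables (K : fieldType) (S : smoothFunctions K).
Local Notation fct := (fpoint S -> K).
Implicit Types f g h l u v p y : fct.

Definition lin_comb f g h : Prop :=
  exists a b : K, forall x, fdom x -> h x = a * f x + b * g x.

Definition binary_form n f g h : Prop :=
  exists c : nat -> K, forall x, fdom x ->
    h x = \sum_(j < n) c j * f x ^+ (n - j.+1) * g x ^+ j.

Lemma binary_form_ext n f g h h' : (forall x, fdom x -> h' x = h x) ->
  binary_form n f g h -> binary_form n f g h'.
Proof. by move=> E [c Hc]; exists c => x Ix; rewrite E// Hc. Qed.

Lemma binary_formZ n f g h a :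
  binary_form n f g h -> binary_form n f g (fun x => a * h x).
Proof.
move=> [c Hc]; exists (fun j => a * c j) => x Ix; rewrite Hc// mulr_sumr.
by apply: eq_bigr => j _; rewrite !mulrA.
Qed.

Lemma binary_form_sum n m f g (F : 'I_m -> fct) :
  (forall i, binary_form n f g (F i)) ->
  binary_form n f g (fun x => \sum_(i < m) F i x).
Proof.
move=> /fin_all_exists[c Hc]; exists (fun j => \sum_i c i j) => x Ix.
rewrite (eq_bigr _ (fun i _ => Hc i x Ix)) exchange_big/=.
by apply: eq_bigr => j _; rewrite !mulr_suml.
Qed.

(** Multiplication by a f + b g adds a times the coefficients to b times the
coefficients shifted by one. *)
Lemma binary_form_mul n f g h l : lin_comb f g l -> binary_form n f g h ->
  binary_form n.+1 f g (fun x => l x * h x).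
Proof.
move=> [a [b Hl]] [c Hc].
exists (fun j => a * (if (j < n)%N then c j else 0) +
                 b * (if j is j'.+1 then c j' else 0)) => x Ix.
rewrite Hl// Hc// mulrDl.
under [RHS]eq_bigr do rewrite !mulrDl.
rewrite big_split/= big_ord_recr/= ltnn mulr0 !mul0r addr0; congr (_ + _).
  rewrite mulr_sumr; apply: eq_bigr => j _.
  by rewrite ltn_ord subSn// exprS; ring.
rewrite big_ord_recl/= mulr0 !mul0r add0r mulr_sumr; apply: eq_bigr => j _.
by rewrite /bump/= add1n subSS exprS; ring.
Qed.

Lemma binary_form_monomial f g p y i j : lin_comb f g p -> lin_comb f g y ->
  binary_form (i + j).+1 f g (fun x => p x ^+ i * y x ^+ j).
Proof.
move=> Lp Ly; elim: i => [|i IH].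
  elim: j => [|j IH].
    by exists (fun=> 1) => x Ix; rewrite big_ord1 !expr0 !mulr1.
  apply: binary_form_ext (binary_form_mul Ly IH) => x _.
  by rewrite exprS; ring.
apply: binary_form_ext (binary_form_mul Lp IH) => x _.
by rewrite exprS mulrA.
Qed.

(** A linear substitution maps forms to forms of the same degree, since each
monomial in p and y is a product of linear combinations of f and g. *)
Lemma binary_form_subst n f g p y h : lin_comb f g p -> lin_comb f g y ->
  binary_form n p y h -> binary_form n f g h.
Proof.
move=> Lp Ly [c Hc].
have Hj (j : 'I_n) : binary_form n f g
    (fun x => c j * (p x ^+ (n - j.+1) * y x ^+ j)).
  apply: binary_formZ.
  have := binary_form_monomial (n - j.+1) j Lp Ly.
  by rewrite -addnS subnK.
apply: binary_form_ext (binary_form_sum Hj) => x Ix.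
by rewrite Hc//; apply: eq_bigr => j _; rewrite mulrA.
Qed.

(** Dehomogenization with respect to a nonvanishing first variable. *)
Lemma binary_form_horner n f g h : (0 < n)%N -> (forall x, fdom x -> f x != 0) ->
  binary_form n f g h <->
  exists2 P : {poly K}, (size P <= n)%N &
    forall x, fdom x -> h x = f x ^+ n.-1 * P.[g x / f x].
Proof.
move=> n0 f0.
have E (P : {poly K}) x : (size P <= n)%N -> fdom x ->
    f x ^+ n.-1 * P.[g x / f x] =
    \sum_(j < n) P`_j * f x ^+ (n - j.+1) * g x ^+ j.
  move=> sP Ix; rewrite (horner_coef_wide _ sP) mulr_sumr.
  apply: eq_bigr => j _.
  have -> : n.-1 = (n - j.+1 + j)%N.
    have jn : (j <= n.-1)%N by rewrite -ltnS prednK.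
    by rewrite -add1n subnDA subn1 subnK.
  rewrite exprD expr_div_n; field.
  by rewrite expf_neq0// f0.
split=> [[c Hc]|[P sP HP]].
  exists (\poly_(j < n) c j) => [|x Ix]; first exact: size_poly.
  rewrite E ?size_poly// Hc//; apply: eq_bigr => j _.
  by rewrite coef_poly ltn_ord.
by exists (fun j => P`_j) => x Ix; rewrite HP// E.
Qed.

End BinaryForms.

(** * The source equation and the kernel of the iterated operator *)

Section SourceEquation.
Variables (K : fieldType) (S : smoothFunctions K).
Hypothesis charK : [pchar K] =i pred0.
Local Notation fct := (fpoint S -> K).
Implicit Types f g h l u v p y t : fct.

Variable r : fct.
Hypotheses (sr : smooth r) (r0 : forall x, fdom x -> r x != 0).

Let natK n : (n.+1%:R : K) != 0.
Proof. by rewrite ((pcharf0P K).1 charK). Qed.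

Let two0 : (2 : K) != 0. Proof. exact: natK. Qed.

(** The parameter - (n - 1) r' / 2 for n = 2. *)
Definition half_param : fct := fun x => - (2^-1 * fderiv r x).
Local Notation Psi2 := (Psi r half_param).

Let smooth_half : smooth half_param.
Proof. exact: (has_derivN (has_derivZ 2^-1
  (has_deriv_fderiv (smooth_fderiv sr)))).1. Qed.

(** Expanding, Psi2 (Psi2 y) = r^2 (y'' + q y) with q the source coefficient. *)
Lemma source_Psi2 y : source_solution r y ->
  forall x, fdom x -> Psi2 (Psi2 y) x = 0.
Proof.
move=> [sy Hy] x Ix.
have dr := has_deriv_fderiv sr; have ddr := has_deriv_fderiv dr.1.
have dr' := has_deriv_fderiv (smooth_fderiv sr).
have dy := has_deriv_fderiv sy; have dy' := has_deriv_fderiv (smooth_fderiv sy).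
have dP := has_derivD (has_derivM dr dy')
  (has_derivM (has_derivN (has_derivZ 2^-1 dr')) dy).
rewrite (Psi_deriv _ _ dP Ix).
have := Hy x Ix; rewrite /source_coef /nderiv /= => E.
have -> : fderiv (fderiv y) x =
  - ((fderiv r x ^+ 2 - 2 * r x * fderiv (fderiv r) x) / (4 * r x ^+ 2)) * y x.
  by apply/eqP; rewrite mulNr -addr_eq0 E.
rewrite /half_param; field.
by rewrite (natK 1) (natK 3) r0.
Qed.

(** Psi2 f = 0 reads f' / f = r' / (2 r): elements of the kernel behave like
constant multiples of the square root of r, and the quotient f g / r has zero
derivative. *)
Lemma Psi2_ker_mul f g : smooth f -> smooth g ->
  (forall x, fdom x -> Psi2 f x = 0) -> (forall x, fdom x -> Psi2 g x = 0) ->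
  exists c, forall x, fdom x -> f x * g x = c * r x.
Proof.
move=> sf sg Pf Pg.
have der q x : (forall x, fdom x -> Psi2 q x = 0) -> fdom x ->
    fderiv q x = 2^-1 * fderiv r x * q x / r x.
  move=> Pq Ix; have := Pq x Ix; rewrite /Psi /half_param mulNr => /subr0_eq <-.
  by rewrite mulrC mulKf// r0.
have dq := has_derivM (has_derivM (has_deriv_fderiv sf) (has_deriv_fderiv sg))
  (has_derivV r0 (has_deriv_fderiv sr)).
have [|c Hc] := @has_deriv0_cst _ _ (fun x => f x * g x / r x).
  apply: has_deriv_eq dq => x Ix; rewrite (der f)// (der g)//.
  by field; rewrite r0.
by exists c => x Ix; rewrite -(Hc x Ix) divfK// r0.
Qed.

(** With f^2 = a r and f g = b r, either a = 0 and f = 0, or f vanishes nowhere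
and g = (b / a) f. *)
Lemma Psi2_ker_line f g : smooth f -> smooth g ->
  (forall x, fdom x -> Psi2 f x = 0) -> (forall x, fdom x -> Psi2 g x = 0) ->
  (forall x, fdom x -> f x = 0) \/
  (forall x, fdom x -> f x != 0) /\
  exists c, forall x, fdom x -> g x = c * f x.
Proof.
move=> sf sg Pf Pg.
have [a Ha] := Psi2_ker_mul sf sf Pf Pf; have [b Hb] := Psi2_ker_mul sf sg Pf Pg.
have [a0|a0] := eqVneq a 0.
  left=> x Ix; apply/eqP; have /eqP := Ha x Ix.
  by rewrite a0 mul0r mulf_eq0 orbb.
have f0 x : fdom x -> f x != 0.
  move=> Ix; apply: contra_neq (mulf_neq0 a0 (r0 Ix)) => fx0.
  by rewrite -Ha// fx0 mul0r.
right; split=> //; exists (b / a) => x Ix.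
apply: (mulfI (f0 x Ix)); rewrite Hb// mulrCA Ha//.
by rewrite mulrA divfK.
Qed.

(** A Jordan chain for Psi2, with the eigenvalue zero; smoothness and
nonvanishing of p make the ratio y / p a legitimate function. *)
Definition adapted p y : Prop :=
  [/\ smooth p, smooth y, forall x, fdom x -> p x != 0,
      forall x, fdom x -> Psi2 p x = 0 & forall x, fdom x -> Psi2 y x = p x].

(** Both Psi2 u and Psi2 v lie in the kernel of Psi2, which is at most a line,
so one of them, if nonzero, serves as p and some combination of u and v lies in
the kernel.  Linear independence of u and v excludes the degenerate cases. *)
Lemma adapted_basis u v : source_solution r u -> source_solution r v ->
  lin_indep2 u v ->
  exists p y, [/\ adapted p y, lin_comb u v p, lin_comb u v y,
                  lin_comb p y u & lin_comb p y v].
Proof.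
move=> solu solv indep.
have su := solu.1; have sv := solv.1.
have sPu := smooth_Psi sr smooth_half su.
have sPv := smooth_Psi sr smooth_half sv.
have PPu := source_Psi2 solu; have PPv := source_Psi2 solv.
have Psi2B a f g x : smooth f -> smooth g -> fdom x ->
    Psi2 (fun x => f x - a * g x) x = Psi2 f x - a * Psi2 g x.
  move=> sf sg Ix.
  have d := has_derivB (has_deriv_fderiv sf) (has_derivZ a (has_deriv_fderiv sg)).
  by rewrite (Psi_deriv _ _ d Ix) /Psi; ring.
have [Pu0|[Pu0 [a Ha]]] := Psi2_ker_line sPu sPv PPu PPv.
  (* Psi2 u = 0, so u itself spans the kernel and Psi2 v is a multiple of u. *)
  have [u0|[u0 [c Hc]]] := Psi2_ker_line su sPv Pu0 PPv.
    have [|/eqP] := indep 1 0; last by rewrite oner_eq0.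
    by move=> x Ix; rewrite u0// mulr0 mul0r addr0.
  have c0 : c != 0.
    apply/eqP => c0.
    have Pv0 x : fdom x -> Psi2 v x = 0 by move=> Ix; rewrite Hc// c0 mul0r.
    have [u0'|[_ [d Hd]]] := Psi2_ker_line su sv Pu0 Pv0.
      have [|/eqP] := indep 1 0; last by rewrite oner_eq0.
      by move=> x Ix; rewrite u0'// mulr0 mul0r addr0.
    have [|_ /eqP] := indep (- d) 1; last by rewrite oner_eq0.
    by move=> x Ix; rewrite Hd//; ring.
  exists (Psi2 v), v; split.
  - by split=> // x Ix; rewrite Hc// mulf_neq0// u0.
  - by exists c, 0 => x Ix; rewrite Hc// mul0r addr0.
  - by exists 0, 1 => x Ix; rewrite mul0r mul1r add0r.
  - by exists c^-1, 0 => x Ix; rewrite Hc// mulKf// mul0r addr0.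
  - by exists 0, 1 => x Ix; rewrite mul0r mul1r add0r.
(* v - a u lies in the kernel, hence is a multiple of Psi2 u. *)
have sz : smooth (fun x => v x - a * u x).
  exact: (has_derivB (has_deriv_fderiv sv) (has_derivZ a (has_deriv_fderiv su))).1.
have Pz x : fdom x -> Psi2 (fun x => v x - a * u x) x = 0.
  by move=> Ix; rewrite Psi2B// Ha// subrr.
have vE : exists c, forall x, fdom x -> v x - a * u x = c * Psi2 u x.
  have [Pu0'|[_ //]] := Psi2_ker_line sPu sz PPu Pz.
  by exists 0 => x Ix; have := Pu0 x Ix; rewrite Pu0' ?eqxx.
have {vE}[c Hc] := vE.
have c0 : c != 0.
  apply/eqP => c0; have [|_ /eqP] := indep (- a) 1; last by rewrite oner_eq0.
  by move=> x Ix; rewrite mulNr mul1r addrC Hc// c0 mul0r.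
exists (Psi2 u), u; split.
- by [].
- exists (- (c^-1 * a)), c^-1 => x Ix.
  by rewrite -[LHS](mulKf c0) -Hc//; ring.
- by exists 1, 0 => x Ix; rewrite mul0r mul1r addr0.
- by exists 0, 1 => x Ix; rewrite mul0r mul1r add0r.
- by exists c, a => x Ix; rewrite -Hc// subrK.
Qed.

(** The parameter t = y / p satisfies r t' = (r y' p - r p' y) / p^2, in which
the terms containing r' cancel and leave 1. *)
Lemma adapted_ratio p y : adapted p y ->
  has_deriv (fun x => y x / p x) (fun x => (r x)^-1).
Proof.
move=> [sp sy p0 Pp Py].
have dq := has_derivM (has_deriv_fderiv sy) (has_derivV p0 (has_deriv_fderiv sp)).
apply: has_deriv_eq dq => x Ix.
have rx := r0 Ix; have px := p0 x Ix.
have E : r x * fderiv p x = 2^-1 * fderiv r x * p x.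
  by have := Pp x Ix; rewrite /Psi /half_param mulNr => /subr0_eq.
have E' : r x * fderiv y x = p x + 2^-1 * fderiv r x * y x.
  by rewrite -(Py x Ix) /Psi /half_param; ring.
apply: (mulfI rx); rewrite mulfV//.
have -> : r x * (fderiv y x / p x + y x * (- fderiv p x / p x ^+ 2)) =
  (r x * fderiv y x) / p x - y x * (r x * fderiv p x) / p x ^+ 2 by ring.
by rewrite E E'; field; rewrite (natK 1) px.
Qed.

Lemma poly_antiderivative n (P : {poly K}) : (size P <= n)%N ->
  exists2 Q : {poly K}, (size Q <= n.+1)%N & Q^`() = P.
Proof.
move=> sP; exists (\poly_(i < n.+1) (P`_i.-1 / i%:R)); first exact: size_poly.
apply/polyP => i; rewrite coef_deriv coef_poly ltnS /=.
have [lt_in|le_ni] := ltnP i n; last by rewrite mul0rn nth_default// (leq_trans sP).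
by rewrite -[LHS]mulr_natr divfK.
Qed.

(** Since r t' = 1, the operator r d/dx acts on polynomials in t as d/dt;
integrating n times from zero introduces n constants. *)
Lemma iter_rD_ker t g n : has_deriv t (fun x => (r x)^-1) -> smooth g ->
  (forall x, fdom x -> iter n (Psi r (fun=> 0)) g x = 0) <->
  exists2 P : {poly K}, (size P <= n)%N & forall x, fdom x -> g x = P.[t x].
Proof.
move=> dt; elim: n g => [|n IH] g sg.
  split=> [H|[P]].
    by exists 0 => [|x Ix]; rewrite ?size_poly0// horner0 -(H x Ix).
  by rewrite leqn0 size_poly_eq0 => /eqP-> E x Ix; rewrite /= E// horner0.
have sDg := smooth_Psi sr (smooth_cst S 0) sg.
have DE x : Psi r (fun=> 0) g x = r x * fderiv g x by rewrite /Psi mul0r addr0.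
split=> [H|[P sP HP] x Ix].
  have [|P sP HP] := (IH _ sDg).1; first by move=> x Ix; rewrite -iterSr H.
  have [Q sQ dQ] := poly_antiderivative sP.
  have [|c Hc] := @has_deriv0_cst _ _ (fun x => g x - Q.[t x]).
    have d := has_derivB (has_deriv_fderiv sg) (has_deriv_horner Q dt).
    apply: has_deriv_eq d => x Ix; apply: (mulfI (r0 Ix)).
    rewrite mulr0 mulrBr -DE HP// dQ mulrCA mulfV ?r0// mulr1.
    by rewrite subrr.
  exists (Q + c%:P) => [|x Ix].
    rewrite (leq_trans (size_polyD _ _))// geq_max sQ.
    by rewrite (leq_trans (size_polyC_leq1 _)).
  by rewrite hornerD hornerC -(Hc x Ix); ring.
rewrite iterSr; move: x Ix; apply/(IH _ sDg); exists P^`() => [|x Ix].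
  have [->|P0] := eqVneq P 0; first by rewrite deriv0 size_poly0.
  by rewrite -ltnS (leq_trans (lt_size_deriv P0)).
have [_ dg] := has_deriv_ext (fun x Ix => esym (HP x Ix)) (has_deriv_horner P dt).
by rewrite DE dg// mulrCA mulfV ?r0// mulr1.
Qed.

Definition iter_param n : fct := fun x => - (2^-1 * n.-1%:R * fderiv r x).

Lemma smooth_iter_param n : smooth (iter_param n).
Proof.
exact: (has_derivN (has_derivZ (2^-1 * n.-1%:R)
  (has_deriv_fderiv (smooth_fderiv sr)))).1.
Qed.

(** By the chain rule, the value is (n-1) p^(n-2) Psi2 p. *)
Lemma Psi_expr n p : smooth p -> (forall x, fdom x -> Psi2 p x = 0) ->
  forall x, fdom x -> Psi r (iter_param n) (fun z => p z ^+ n.-1) x = 0.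
Proof.
move=> sp Pp x Ix; rewrite (Psi_deriv _ _ (has_derivX n.-1 (has_deriv_fderiv sp)) Ix).
have -> : r x * (n.-1%:R * p x ^+ n.-2 * fderiv p x) +
    iter_param n x * p x ^+ n.-1 = n.-1%:R * p x ^+ n.-2 * Psi2 p x.
  rewrite /iter_param /Psi /half_param.
  by case: n.-1 => [|k] /=; rewrite ?exprS; ring.
by rewrite Pp// mulr0.
Qed.

(** By the Leibniz rule Psi [f g] = Psi[f] g + f (r g'), so multiplication by an
f in the kernel of Psi conjugates Psi to r d/dx. *)
Lemma iter_Psi_mul s f g n : smooth s -> smooth f -> smooth g ->
  (forall x, fdom x -> Psi r s f x = 0) -> forall x, fdom x ->
  iter n (Psi r s) (fun z => f z * g z) x = f x * iter n (Psi r (fun=> 0)) g x.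
Proof.
move=> ss sf sg Pf; elim: n => [//|n IH] x Ix; rewrite !iterS.
have sDg := smooth_iter_Psi sr (smooth_cst S 0) n sg.
have sfg := (has_derivM (has_deriv_fderiv sf) (has_deriv_fderiv sg)).1.
rewrite (Psi_ext r s (smooth_iter_Psi sr ss n sfg) IH Ix).
rewrite (Psi_deriv _ _ (has_derivM (has_deriv_fderiv sf) (has_deriv_fderiv sDg)) Ix).
have := Pf x Ix; rewrite /Psi => E.
have -> : r x * (fderiv f x * iter n (Psi r (fun=> 0)) g x +
     f x * fderiv (iter n (Psi r (fun=> 0)) g) x) +
     s x * (f x * iter n (Psi r (fun=> 0)) g x) =
  (r x * fderiv f x + s x * f x) * iter n (Psi r (fun=> 0)) g x +
   f x * (r x * fderiv (iter n (Psi r (fun=> 0)) g) x) by ring.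
by rewrite E !mul0r add0r addr0.
Qed.

(** Writing w = p^(n-1) g in an adapted basis turns the equation into
(r d/dx)^n g = 0, hence g into a polynomial in y / p and w into a binary form
in p and y. *)
Lemma iter_Psi_ker n u v w : (0 < n)%N ->
  source_solution r u -> source_solution r v -> lin_indep2 u v ->
  smooth w /\ (forall x, fdom x -> iter n (Psi r (iter_param n)) w x = 0) <->
  binary_form n u v w.
Proof.
move=> n0 solu solv indep.
have [p [y [apy Lp Ly Lu Lv]]] := adapted_basis solu solv indep.
have dt := adapted_ratio apy; have [sp sy p0 Pp Py] := apy.
pose q : fct := fun x => p x ^+ n.-1.
have sq : smooth q := (has_derivX n.-1 (has_deriv_fderiv sp)).1.
have q0 x : fdom x -> q x != 0 by move=> Ix; rewrite expf_neq0// p0.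
have sV := smoothV sq q0.
have Pq : forall x, fdom x -> Psi r (iter_param n) q x = 0 := Psi_expr n sp Pp.
have ss := smooth_iter_param n.
split=> [[sw Hw]|Bw].
  have sg : smooth (fun x => w x / q x) := smoothM sw sV.
  have [|P sP HP] := (iter_rD_ker n dt sg).1.
    move=> x Ix; apply: (mulfI (q0 x Ix)).
    rewrite -(iter_Psi_mul n ss sq sg Pq Ix) mulr0 -(Hw x Ix).
    apply/esym; apply: iter_Psi_ext Ix => // z Iz.
    by rewrite mulrC divfK// q0.
  apply: (binary_form_subst Lp Ly); apply/(binary_form_horner _ _ n0 p0).
  by exists P => // x Ix; rewrite -HP// mulrC divfK// q0.
have /(binary_form_horner _ _ n0 p0)[P sP HP] := binary_form_subst Lu Lv Bw.
have sPt := (has_deriv_horner P dt).1.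
have sqP := smoothM sq sPt.
have qPw x : fdom x -> q x * P.[y x / p x] = w x by move=> Ix; rewrite HP.
split=> [|x Ix]; first exact: smooth_ext sqP.
rewrite -(iter_Psi_ext sr ss n sqP qPw Ix) (iter_Psi_mul n ss sq sPt Pq Ix).
have /(iter_rD_ker n dt sPt).2 : exists2 P' : {poly K}, (size P' <= n)%N &
    forall x, fdom x -> P.[y x / p x] = P'.[y x / p x] by exists P.
by move=> ->//; rewrite mulr0.
Qed.

(** Iterativity prescribes only the coefficients of index at least 2; the two
leading ones are r^n and 0. *)
Lemma iterative_Psi n (A : nat -> fct) w : (2 <= n)%N -> iterative n A r ->
  smooth w -> forall x, fdom x ->
  iter n (Psi r (iter_param n)) w x = r x ^+ n *
    (nderiv n w x + \sum_(2 <= j < n.+1) A j x * nderiv (n - j) w x).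
Proof.
move=> n2 [_ _ [k Hk HA]] sw x Ix.
have ss := smooth_iter_param n; have n1 := ltnW n2.
have kE := Psi_coefs_uniq charK Hk (Psi_coefsP sr ss n).
rewrite (Hk.2 w sw x Ix) big_ltn// big_ltn ?ltnS//.
have -> : k 0 x = r x ^+ n by rewrite kE// Psi_coef0.
have -> : k 1%N x = 0.
  rewrite kE//; apply: (mulfI (mulf_neq0 two0 (r0 Ix))).
  rewrite mulr0 -mulrA (Psi_coef1 sr ss n Ix).
  by rewrite /iter_param; field.
rewrite mul0r add0r subn0 mulrDr; congr (_ + _).
rewrite mulr_sumr; apply: eq_big_nat => j jn.
by rewrite HA// mulrA [r x ^+ n * _]mulrC divfK// expf_neq0// r0.
Qed.

End SourceEquation.

Theorem mainTheorem3 (K : fieldType) (charK : [pchar K] =i pred0)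
    (S : smoothFunctions K) (m n : nat) (m_ge1 : (1 <= m)%N) (n_ge2 : (2 <= n)%N)
    (A : nat -> fpoint S -> K) (r u v : fpoint S -> K)
    (smoothA : forall j, (2 <= j <= n)%N -> smooth (A j))
    (iterA : iterative n A r)
    (solu : source_solution r u) (solv : source_solution r v)
    (indep_uv : lin_indep2 u v) (w : fpoint S -> 'cV[K]_m) :
  system_solution n A w <->
  (exists C : 'M[K]_(m, n), forall (x : fpoint S), fdom x -> forall i : 'I_m,
     w x i 0 = \sum_(j < n) C i j * u x ^+ (n - j.+1) * v x ^+ j).
Proof.
have [sr r0 _] := iterA.
pose wi i : fpoint S -> K := fun x => w x i 0.
have ker i := iter_Psi_ker charK sr r0 (wi i) (ltnW n_ge2) solu solv indep_uv.
have sysE x i : (vnderiv n w x +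
    \sum_(2 <= j < n.+1) (A j x *: 1%:M) *m vnderiv (n - j) w x) i 0 =
    nderiv n (wi i) x + \sum_(2 <= j < n.+1) A j x * nderiv (n - j) (wi i) x.
  rewrite !mxE summxE; congr (_ + _); apply: eq_bigr => j _.
  by rewrite -scalemxAl mul1mx !mxE.
split=> [[sw Hw]|[C HC]].
  have /fin_all_exists[c Hc] i : binary_form n u v (wi i).
    apply/ker; split=> [|x Ix]; first exact: sw.
    by rewrite (iterative_Psi charK sr r0 n_ge2 iterA (sw i) Ix) -sysE Hw// mxE mulr0.
  exists (\matrix_(i, j) c i j) => x Ix i; rewrite -/(wi i x) Hc//.
  by apply: eq_bigr => j _; rewrite mxE.
have B i : binary_form n u v (wi i).
  exists (fun j => if insub j is Some j' then C i j' else 0) => x Ix.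
  by rewrite /wi HC//; apply: eq_bigr => j _; rewrite valK.
have Hw i := (ker i).2 (B i).
split=> [i|x Ix]; first exact: (Hw i).1.
apply/colP => i; rewrite sysE mxE.
apply: (mulfI (expf_neq0 n (r0 x Ix))); rewrite mulr0.
by rewrite -(iterative_Psi charK sr r0 n_ge2 iterA (Hw i).1 Ix) (Hw i).2.
Qed.
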